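(* Let $n<m$ be positive integers, let $L$ be a real $m\times m$ matrix, let $G$ be a real $m\times n$ matrix of rank $n$, let $A$ be a real symmetric positive definite $m\times m$ matrix, and let $v_0\in\mathbb R^n$. Put $M=G^TA^{-1}G$, $K=LA^{-1}$, and $$E=L^TG+GM^{-1}G^TKG.$$ Let $e(t)=\langle u(t)\rangle_{approx}-\langle u(t)\rangle_{exact}$, where $\langle u(t)\rangle_{exact}=e^{tL}A^{-1}GM^{-1}v_0$ and $\langle u(t)\rangle_{approx}=A^{-1}GM^{-1}v(t)$ with $v$ the solution of $\dot v(t)=G^TKGM^{-1}v(t)$, $v(0)=v_0$. If $L^TA+AL=0$, then for all $t\ge0$ $$|A^{1/2}e(t)|\le t\,|A^{-1/2}EM^{-1/2}|\,|M^{-1/2}v_0|.$$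
   Context: $|\cdot|$ denotes the Euclidean norm of vectors and the induced operator ($2$-)norm of matrices; $A^{1/2}$, $M^{-1/2}$, etc. denote the symmetric positive definite powers. (Here $\langle u(t)\rangle_{exact}$ is the mean of all solutions of $\dot u=Lu$ with $G^Tu(0)=v_0$, with respect to the Gaussian measure with density proportional to $e^{-\frac12u^TAu}$ restricted to $\{G^Tu(0)=v_0\}$ and renormalized.) *)

(* Defs.v *)
(* MathComp-Analysis *)
From mathcomp Require Export all_boot all_order all_algebra.
From mathcomp Require Export all_classical all_reals all_analysis.
Export Order.TTheory GRing.Theory Num.Theory.
Export numFieldNormedType.Exports.

Set Implicit Arguments.
Unset Strict Implicit.
Unset Printing Implicit Defensive.

Local Open Scope classical_set_scope.
Local Open Scope ring_scope.

(* The library norm `|x| on matrices is the entrywise sup norm, so the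
   Euclidean norm and its operator norm are defined here. *)
Definition enorm (R : realType) (n : nat) (x : 'cV[R]_n) : R :=
  Num.sqrt (\sum_(i < n) x i 0 ^+ 2).

Definition opnorm (R : realType) (m n : nat) (B : 'M[R]_(m, n)) : R :=
  sup [set enorm (B *m x) | x in [set x : 'cV[R]_n | enorm x <= 1]].

Definition posdefmx (R : realType) (n : nat) (A : 'M[R]_n) : Prop :=
  A^T = A /\ forall x : 'cV[R]_n, x != 0 -> 0 < (x^T *m A *m x) 0 0.

(* The symmetric positive definite square root, which exists and is unique
   when A is symmetric positive definite; the value is 0 if there is none. *)
Definition sqrtmx (R : realType) (n : nat) (A : 'M[R]_n) : 'M[R]_n :=
  xget 0 [set B | posdefmx B /\ B *m B = A].

Definition expmx (R : realType) (n : nat) (A : 'M[R]_n) : 'M[R]_n :=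
  limn (series (fun k : nat => (k`!%:R)^-1 *: A ^+ k)).

(* v solves v' = B v on [0, +oo[ with v(0) = v0; values at negative times are
   unconstrained.  Continuity at 0 and the equation for t > 0 give the
   one-sided equation at t = 0. *)
Definition linear_ode_solution (R : realType) (n : nat) (B : 'M[R]_n)
    (v0 : 'cV[R]_n) (v : R -> 'cV[R]_n) : Prop :=
  [/\ v 0 = v0,
      {within `[0, +oo[, continuous v} &
      forall t : R, 0 < t -> is_derive t 1 v (B *m v t)].

(* Main.v *)
(* The error e = u_approx - u_exact solves e' = L e + A^-1 E M^-1 v with
   e(0) = 0.  Since A L and K are skew-symmetric, the first term does not change
   |A^(1/2) e|, and |M^(-1/2) v| is nonincreasing (in fact constant); hence
   |A^(1/2) e| grows at rate at most |A^(-1/2) E M^(-1/2)| |M^(-1/2) v0|. *)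
Require Import Defs.
From mathcomp Require Import spectral complex ring lra.

Set Implicit Arguments.
Unset Strict Implicit.
Unset Printing Implicit Defensive.

Local Open Scope classical_set_scope.
Local Open Scope ring_scope.

(** * Polynomial interpolation and the spectrum of symmetric matrices *)

Lemma interpolation (F : fieldType) (s : seq F) (g : F -> F) :
  exists q : {poly F}, forall x, x \in s -> q.[x] = g x.
Proof.
elim: s => [|x s [q qE]]; first by exists 0.
have [xs|xs] := boolP (x \in s).
  by exists q => y; rewrite inE => /predU1P[->|]; exact: qE.
(* Newton's scheme: a multiple of [p], which vanishes at the old nodes, corrects the value at
   [x]. *)
pose p := \prod_(y <- s) ('X - y%:P).
have px : p.[x] != 0 by rewrite -/(root p x) root_prod_XsubC.
exists (q + ((g x - q.[x]) / p.[x])%:P * p) => y.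
rewrite inE hornerD hornerCM => /predU1P[->|ys].
  by rewrite divfK// subrKC.
have /rootP -> : root p y by rewrite root_prod_XsubC.
by rewrite mulr0 addr0 qE.
Qed.

(* Over R[i] the matrix is unitarily diagonalizable with real spectrum. *)
Lemma sym_annihilating_roots (R : rcfType) (n : nat) (A : 'M[R]_n.+1) :
  A^T = A -> exists s : seq R,
    (forall r, r \in s -> eigenvalue A r) /\
    forall q : {poly R}, (forall r, r \in s -> q.[r] = 0) -> horner_mx A q = 0.
Proof.
move=> symA; pose f : {rmorphism R -> R[i]} := real_complex R.
pose Ac := map_mx f A.
have hermA : Ac \is hermsymmx.
  apply/is_hermitianmxP; rewrite expr0 scale1r.
  apply/matrixP => i j; rewrite !mxE -[in LHS]symA mxE.
  by apply/eqP; rewrite eq_complex /= oppr0 !eqxx.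
have := hermitian_spectral_diag_real hermA.
have /hermitian_normalmx /orthomx_spectralP := hermA.
set P := spectralmx Ac; set d := spectral_diag Ac => AcE dreal.
have Pu : P \in unitmx by exact: spectral_unit.
pose r i := complex.Re (d 0 i).
have rE i : f (r i) = d 0 i.
  have /Creal_ImP : d 0 i \is Num.real by exact: (mxOverP dreal).
  rewrite /r; case: (d 0 i) => a b /=.
  by rewrite -complexIm => -[->].
exists [seq r i | i <- enum 'I_n.+1]; split.
  move=> _ /mapP[i _ ->].
  (* Roots of the characteristic polynomial pass between [R] and [R[i]]; over [R[i]], row [i] of [P]
     is a left eigenvector. *)
  rewrite eigenvalue_root_char -(fmorph_root f). rewrite rE map_char_poly.
  rewrite -eigenvalue_root_char; apply/eigenvalueP; exists (row i P).
    rewrite -row_mul -/Ac AcE !mulmxA mulmxV// mul1mx.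
    by apply/rowP => j; rewrite mul_diag_mx !mxE.
  apply: contraTneq Pu => Pi0.
  have Ei : delta_mx 0 i *m P = 0 :> 'rV_n.+1 by rewrite -rowE.
  apply/negP => Pu; have := congr1 (mulmx^~ (invmx P)) Ei.
  by rewrite mulmxK// mul0mx => /rowP/(_ i)/eqP; rewrite !mxE !eqxx oner_eq0.
(* Over [R[i]], [q] of the matrix is conjugate to the diagonal matrix of the values of [q] on the
   spectrum, all of them 0. *)
move=> q q0; apply: (@map_mx_inj _ _ f); rewrite map_mx0 map_horner_mx -/Ac.
rewrite AcE.
rewrite horner_mx_uconjC// horner_mx_diag.
rewrite (_ : map_mx _ d = 0).
  rewrite (_ : diag_mx 0 = 0) ?mulmx0 ?mul0mx//.
  by apply/matrixP => i j; rewrite !mxE mul0rn.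
apply/rowP => i; rewrite !mxE -rE horner_map q0 ?rmorph0//.
by apply/mapP; exists i => //; rewrite mem_enum.
Qed.

(** * Euclidean and operator norms *)

Lemma sqr_enorm (R : realType) (n : nat) (x : 'cV[R]_n) :
  enorm x ^+ 2 = (x^T *m x) 0 0.
Proof.
rewrite sqr_sqrtr; last by apply: sumr_ge0 => i _; exact: sqr_ge0.
by rewrite mxE; apply: eq_bigr => i _; rewrite mxE.
Qed.

Lemma enorm_ge0 (R : realType) (n : nat) (x : 'cV[R]_n) : 0 <= enorm x.
Proof. exact: sqrtr_ge0. Qed.

Lemma enorm_eq0 (R : realType) (n : nat) (x : 'cV[R]_n) :
  (enorm x == 0) = (x == 0).
Proof.
apply/eqP/eqP => [/eqP|->]; last first.
  by rewrite /enorm big1 ?sqrtr0// => i _; rewrite mxE expr0n.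
rewrite sqrtr_eq0 => x0; apply/colP => i; rewrite mxE; apply/eqP.
rewrite -sqrf_eq0 eq_le sqr_ge0 andbT (le_trans _ x0)//.
by rewrite (bigD1 i)//= lerDl sumr_ge0// => j _; exact: sqr_ge0.
Qed.

Lemma enorm0 (R : realType) (n : nat) : enorm (0 : 'cV[R]_n) = 0.
Proof. by apply/eqP; rewrite enorm_eq0. Qed.

Lemma enormZ (R : realType) (n : nat) (a : R) (x : 'cV[R]_n) :
  enorm (a *: x) = `|a| * enorm x.
Proof.
rewrite /enorm -sqrtr_sqr -sqrtrM ?sqr_ge0// mulr_sumr.
by congr Num.sqrt; apply: eq_bigr => i _; rewrite mxE exprMn.
Qed.

Lemma coord_le_enorm (R : realType) (n : nat) (x : 'cV[R]_n) (i : 'I_n) :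
  `|x i 0| <= enorm x.
Proof.
rewrite -sqrtr_sqr ler_wsqrtr// (bigD1 i)//= lerDl.
by rewrite sumr_ge0// => j _; exact: sqr_ge0.
Qed.

Lemma dot_sym (R : comPzRingType) (n : nat) (x y : 'cV[R]_n) :
  (x^T *m y) 0 0 = (y^T *m x) 0 0.
Proof. by rewrite -[in RHS](trmxK x) -trmx_mul [RHS]mxE. Qed.

Lemma cauchy_schwarz (R : realType) (n : nat) (x y : 'cV[R]_n) :
  (x^T *m y) 0 0 <= enorm x * enorm y.
Proof.
have [->|x0] := eqVneq x 0.
  by rewrite trmx0 mul0mx mxE mulr_ge0// enorm_ge0.
have [->|y0] := eqVneq y 0.
  by rewrite mulmx0 mxE mulr_ge0// enorm_ge0.
have X : 0 < enorm x by rewrite lt0r enorm_eq0 x0 enorm_ge0.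
have Y : 0 < enorm y by rewrite lt0r enorm_eq0 y0 enorm_ge0.
(* Here [|z|^2 = 2 |x| |y| (|x| |y| - x^T y)], and the factor [2 |x| |y|] is positive. *)
pose z := enorm y *: x - enorm x *: y.
have : 0 <= (z^T *m z) 0 0 by rewrite -sqr_enorm sqr_ge0.
have -> : z^T = enorm y *: x^T - enorm x *: y^T.
  by apply/matrixP => i j; rewrite !mxE.
rewrite mulmxBl !mulmxBr -!scalemxAl -!scalemxAr !scalerA.
have E (a b c d : 'M[R]_1) : (a - b - (c - d)) 0 0
  = a 0 0 - b 0 0 - (c 0 0 - d 0 0) by rewrite !mxE.
have EZ k (a : 'M[R]_1) : (k *: a) 0 0 = k * a 0 0 by rewrite mxE.
rewrite E !EZ.
rewrite -!sqr_enorm (dot_sym y x).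
move: (enorm x) (enorm y) ((x^T *m y) 0 0) X Y => a b c a0 b0 H.
have : 0 <= 2 * (a * b) * (a * b - c).
  by rewrite (le_trans H)// le_eqVlt; apply/orP; left; apply/eqP; ring.
by rewrite pmulr_rge0 ?subr_ge0// !mulr_gt0.
Qed.

(** Boundedness makes the [sup] in [opnorm] a genuine supremum. Coordinates of a vector of the unit
    ball are at most 1 in absolute value, so the absolute row sums of [B] give a bound. *)
Lemma opnorm_has_ubound (R : realType) (m n : nat) (B : 'M[R]_(m, n)) :
  has_ubound [set enorm (B *m x) | x in [set x : 'cV[R]_n | enorm x <= 1]].
Proof.
exists (Num.sqrt (\sum_(i < m) (\sum_(j < n) `|B i j|) ^+ 2)).
move=> _ [x /= x1 <-]; rewrite ler_wsqrtr// ler_sum// => i _.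
rewrite mxE -real_normK ?num_real// lerXn2r ?nnegrE ?sumr_ge0//.
rewrite (le_trans (ler_norm_sum _ _ _))// ler_sum// => j _.
by rewrite normrM ler_piMr// (le_trans (coord_le_enorm _ _)).
Qed.

Lemma opnorm_ge0 (R : realType) (m n : nat) (B : 'M[R]_(m, n)) : 0 <= opnorm B.
Proof.
apply: (ub_le_sup (opnorm_has_ubound B)).
by exists 0; rewrite ?mulmx0 /= enorm0 ?ler01.
Qed.

Lemma enorm_mul_le_opnorm (R : realType) (m n : nat) (B : 'M[R]_(m, n))
    (x : 'cV[R]_n) : enorm (B *m x) <= opnorm B * enorm x.
Proof.
have [->|x0] := eqVneq x 0; first by rewrite mulmx0 !enorm0 mulr0.
have X : 0 < enorm x by rewrite lt0r enorm_eq0 x0 enorm_ge0.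
rewrite -ler_pdivrMr// mulrC -[(enorm x)^-1]gtr0_norm ?invr_gt0//.
rewrite -enormZ scalemxAr; apply: (ub_le_sup (opnorm_has_ubound B)).
exists ((enorm x)^-1 *: x) => //=.
by rewrite enormZ gtr0_norm ?invr_gt0// mulVf// gt_eqF.
Qed.

(** * Positive definite matrices and their square roots *)

Lemma posdefmx_unit (R : realType) (n : nat) (A : 'M[R]_n) :
  posdefmx A -> A \in unitmx.
Proof.
move=> [_ posA]; rewrite -row_free_unit; apply: inj_row_free => v vA0.
apply/eqP/negP => /negP v0; have := posA v^T.
by rewrite trmx_eq0 v0 trmxK vA0 mul0mx mxE ltxx => /(_ isT).
Qed.

Lemma posdefmx_congr (R : realType) (m n : nat) (A : 'M[R]_m)
    (G : 'M[R]_(m, n)) :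
  posdefmx A -> \rank G = n -> posdefmx (G^T *m A *m G).
Proof.
move=> [symA posA] rankG; split.
  by rewrite !trmx_mul trmxK symA mulmxA.
move=> x x0; have := posA (G *m x).
rewrite trmx_mul !mulmxA; apply; apply: contra_neq x0 => Gx0.
(* Full column rank makes [G] injective on column vectors. *)
have freeG : row_free G^T by rewrite /row_free mxrank_tr rankG.
apply: trmx_inj; apply: (row_free_inj freeG).
by rewrite -trmx_mul Gx0 !trmx0 mul0mx.
Qed.

Lemma posdefmx_inv (R : realType) (n : nat) (A : 'M[R]_n) :
  posdefmx A -> posdefmx (invmx A).
Proof.
move=> posA; have Au := posdefmx_unit posA; have [symA _] := posA.
have E : (invmx A)^T *m A *m invmx A = invmx A.
  by rewrite trmx_inv symA mulVmx// mul1mx.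
by rewrite -E; apply: posdefmx_congr => //; rewrite mxrank_unit// unitmx_inv.
Qed.

Lemma trmx_horner (R : comNzRingType) (n : nat) (A : 'M[R]_n.+1)
    (q : {poly R}) :
  A^T = A -> (horner_mx A q)^T = horner_mx A q.
Proof.
move=> symA; elim/poly_ind: q => [|q c IH]; first by rewrite !rmorph0 trmx0.
rewrite rmorphD rmorphM /= horner_mx_X horner_mx_C linearD /= tr_scalar_mx.
rewrite -mulmxE trmx_mul IH symA; congr (_ + _).
exact/comm_mx_horner/comm_mx_refl.
Qed.

(** Since [xget] returns a witness whenever there is one, existence is enough. A root is found among
    the polynomials in [A], which are determined by their values on the spectrum. *)
Lemma sqrtmxP (R : realType) (n : nat) (A : 'M[R]_n) : posdefmx A ->
  posdefmx (sqrtmx A) /\ sqrtmx A *m sqrtmx A = A.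
Proof.
move=> posA.
suff [B PB] : exists B, posdefmx B /\ B *m B = A
  by apply: (@xgetPex _ 0 [set B | posdefmx B /\ B *m B = A]); exists B.
(* [horner_mx] is stated for size [n.+1]; the empty matrix is its own root. *)
case: n => [|n] in A posA *.
  by exists A; split=> //; apply/matrixP => -[].
have [symA A_gt0] := posA.
have [s [s_eig s_ann]] := sym_annihilating_roots symA.
(* C interpolates the fourth root, so that C^2 = C^T C is positive definite. *)
have [q qE] := interpolation s (fun r => Num.sqrt (Num.sqrt r)).
pose C := horner_mx A q.
have symC : C^T = C by exact: trmx_horner.
have CA : C *m C *m (C *m C) = A.
  rewrite !mulmxE -!rmorphM /= -[RHS](horner_mx_X A); apply/eqP.
  rewrite -subr_eq0 -rmorphB /=; apply/eqP/s_ann => r rs.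
  (* A left eigenvector [v] gives [v A v^T = r |v|^2]. Positivity of [r] ensures that the fourth
     power of its iterated [Num.sqrt] is [r]. *)
  have r_gt0 : 0 < r.
    have /eigenvalueP[v vA v0] := s_eig _ rs.
    have := A_gt0 v^T; rewrite trmx_eq0 => /(_ v0).
    rewrite trmxK vA -scalemxAl mxE -{1}[v]trmxK -sqr_enorm.
    by rewrite pmulr_lgt0// exprn_gt0// lt0r enorm_eq0 trmx_eq0 v0 enorm_ge0.
  rewrite hornerD hornerN hornerX !hornerM qE// -!expr2 sqr_sqrtr ?sqrtr_ge0//.
  by rewrite sqr_sqrtr ?subrr// ltW.
exists (C *m C); split=> //; split; first by rewrite trmx_mul symC.
move=> x x0; rewrite -{1}symC !mulmxA -trmx_mul -mulmxA -sqr_enorm.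
rewrite exprn_gt0// lt0r enorm_ge0 enorm_eq0 andbT.
(* [C x = 0] would give [A x = C^4 x = 0]. *)
apply: contra_neq x0 => Cx0; have Au := posdefmx_unit posA.
by rewrite -[x](mulKmx Au) -{2}CA -!mulmxA Cx0 !mulmx0.
Qed.

(** * Entrywise limits and derivatives of matrix functions *)

Lemma cvg_mx (T : Type) (F : set_system T) {FF : Filter F} (R : realType)
    (m n : nat) (u : T -> 'M[R]_(m, n)) (l : 'M[R]_(m, n)) :
  (forall i j, u x i j @[x --> F] --> l i j) -> u @ F --> l.
Proof.
move=> ul A [P lP PA]; rewrite /nbhs/=.
(* A matrix neighbourhood contains a product of neighbourhoods of the entries, and there are
   finitely many entries. *)
have : F (fun x => forall i j, P i j (u x i j)).
  by apply: filter_forall => i; apply: filter_forall => j; exact: ul.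
by apply: filterS => x Px; exact: PA.
Qed.

Lemma is_derive_mxP (R : realFieldType) (V : normedModType R) (m n : nat)
    (M : V -> 'M[R]_(m, n)) (dM : 'M[R]_(m, n)) (t v : V) :
  is_derive t v M dM <->
  forall i j, is_derive t v (fun s => M s i j) (dM i j).
Proof.
split=> [dMt i j|dMt].
  have /derivable_mxP dv := @ex_derive _ _ _ _ _ _ _ dMt.
  by split; [exact: dv|rewrite -(@derive_val _ _ _ _ _ _ _ dMt) derive_mx ?mxE].
have dv : derivable M t v by apply/derivable_mxP => i j; exact: ex_derive.
split=> //; rewrite derive_mx//; apply/matrixP => i j; rewrite mxE.
exact: derive_val.
Qed.

Lemma is_derive_sumr (R : realFieldType) (V : normedModType R) (n : nat)
    (h : 'I_n -> V -> R) (dh : 'I_n -> R) (t v : V) :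
  (forall i, is_derive t v (h i) (dh i)) ->
  is_derive t v (fun s => \sum_i h i s) (\sum_i dh i).
Proof.
move=> dht; have -> : (fun s => \sum_i h i s) = \sum_i h i.
  by apply/funext => s; rewrite fct_sumE.
exact: is_derive_sum.
Qed.

Lemma is_derive_mulmx (R : realFieldType) (V : normedModType R) (m n p : nat)
    (P : 'M[R]_(m, n)) (M : V -> 'M[R]_(n, p)) (dM : 'M[R]_(n, p)) (t v : V) :
  is_derive t v M dM -> is_derive t v (fun s => P *m M s) (P *m dM).
Proof.
move=> /is_derive_mxP dMt; apply/is_derive_mxP => i j; rewrite mxE.
under eq_fun do rewrite mxE.
apply: is_derive_sumr => k; apply: is_deriveZ.
Qed.

Lemma is_derive_mulmxr (R : realFieldType) (V : normedModType R) (m n p : nat)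
    (M : V -> 'M[R]_(m, n)) (P : 'M[R]_(n, p)) (dM : 'M[R]_(m, n)) (t v : V) :
  is_derive t v M dM -> is_derive t v (fun s => M s *m P) (dM *m P).
Proof.
move=> /is_derive_mxP dMt; apply/is_derive_mxP => i j; rewrite mxE.
under eq_fun do rewrite mxE.
apply: is_derive_sumr => k.
under eq_fun do rewrite mulrC.
rewrite mulrC; apply: is_deriveZ.
Qed.

(** * The matrix exponential and its derivative *)

Lemma exprmxZ (R : comPzRingType) (n : nat) (a : R) (A : 'M[R]_n) (k : nat) :
  (a *: A) ^+ k = a ^+ k *: A ^+ k.
Proof.
elim: k => [|k IH]; first by rewrite !expr0 scale1r.
by rewrite !exprS IH -mulmxE -scalemxAl -scalemxAr scalerA.
Qed.

(** Comparison with [D] times the exponential series at [S * |x|]. *)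
Lemma is_cvg_pseries_factorial_bound (R : realType) (c : R^nat) (D S x : R) :
  (forall k, `|c k| <= D * (k`!%:R^-1 * S ^+ k)) -> cvgn (pseries c x).
Proof.
move=> cS; apply: normed_cvg.
have le_exp k : `|c k * x ^+ k| <= D * exp_coeff (S * `|x|) k.
  rewrite normrM normrX exp_coeffE/= exprMn !mulrA ler_wpM2r ?exprn_ge0//.
  by rewrite -!mulrA.
apply: (@series_le_cvg _ _ (fun k => D * exp_coeff (S * `|x|) k)) => [k|k|//|].
- exact: normr_ge0.
- by apply: le_trans (le_exp k); exact: normr_ge0.
- by apply: is_cvg_seriesZ; exact: is_cvg_series_exp_coeff.
Qed.

Section exponential.
Variables (R : realType) (n : nat) (L : 'M[R]_n).

(** Each entry of [expmx (t *: L)] is a scalar power series in [t] with coefficients [c i j], so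
    scalar termwise differentiation applies. [S] dominates every absolute row sum of [L], hence
    [S ^+ k] the entries of [L ^+ k]. *)
Let c (i j : 'I_n) (k : nat) : R := k`!%:R^-1 * (L ^+ k) i j.
Let E (t : R) : 'M[R]_n := \matrix_(i, j) limn (pseries (c i j) t).
Let S : R := \sum_i \sum_j `|L i j|.

Let S_ge0 : 0 <= S.
Proof. by apply: sumr_ge0 => i _; apply: sumr_ge0. Qed.

Let exprL_bound k i j : `|(L ^+ k) i j| <= S ^+ k.
Proof.
elim: k => [|k IH] in i j *.
  by rewrite !expr0 mxE; case: eqP => _; rewrite ?normr1 ?normr0.
rewrite !exprS mxE (le_trans (ler_norm_sum _ _ _))//.
apply: (@le_trans _ _ (\sum_l `|L i l| * S ^+ k)).
  by apply: ler_sum => l _; rewrite normrM ler_wpM2l.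
rewrite -mulr_suml ler_wpM2r ?exprn_ge0//.
rewrite /S [leRHS](bigD1 i)//= lerDl.
by apply: sumr_ge0 => l _; apply: sumr_ge0.
Qed.

Let cvg_c i j (t : R) : cvgn (pseries (c i j) t).
Proof.
apply: (@is_cvg_pseries_factorial_bound _ _ 1 S) => k.
by rewrite mul1r normrM ger0_norm ?invr_ge0// ler_wpM2l ?invr_ge0.
Qed.

Let diffs_c i j : pseries_diffs (c i j) = fun k => \sum_l L i l * c l j k.
Proof.
apply/funext => k; rewrite /pseries_diffs /c factS natrM invfM mulrA mulVKf//.
rewrite exprS mxE mulr_sumr; apply: eq_bigr => l _; ring.
Qed.

Let cvg_sum_c (a : 'I_n -> R) j (t : R) :
  pseries (fun k => \sum_l a l * c l j k) t @ \oo -->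
  \sum_l a l * limn (pseries (c l j) t).
Proof.
have -> : pseries (fun k => \sum_l a l * c l j k) t =
    fun N => \sum_l a l * pseries (c l j) t N.
  apply/funext => N; rewrite /pseries/= /series/=.
  under [RHS]eq_bigr do rewrite mulr_sumr.
  rewrite [RHS]exchange_big/=; apply: eq_bigr => k _.
  by rewrite mulr_suml; apply: eq_bigr => l _; rewrite mulrA.
apply: cvg_big => [|l _]; first exact: add_continuous.
by apply: cvgMr; exact: cvg_c.
Qed.

(** Formal differentiation turns the row of weights [a] into [a L], so the second derivative series
    has the same shape and converges by [cvg_sum_c]. *)
Let diffs_sum_c (a : 'I_n -> R) j :
  pseries_diffs (fun k => \sum_l a l * c l j k) =
  fun k => \sum_l (\sum_h a h * L h l) * c l j k.
Proof.
apply/funext => k; rewrite /pseries_diffs mulr_sumr.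
transitivity (\sum_h a h * pseries_diffs (c h j) k).
  by apply: eq_bigr => h _; rewrite /pseries_diffs mulrCA.
under eq_bigr do rewrite diffs_c mulr_sumr.
rewrite exchange_big; apply: eq_bigr => l _ /=.
by rewrite mulr_suml; apply: eq_bigr => h _; rewrite mulrA.
Qed.

Let expmx_pseries (t : R) : expmx (t *: L) = E t.
Proof.
apply/cvg_lim => //; apply: cvg_mx => i j; rewrite mxE.
have -> : (fun N => series (fun k : nat => k`!%:R^-1 *: (t *: L) ^+ k) N i j) =
    pseries (c i j) t; last exact: cvg_c.
apply/funext => N; rewrite /series/= summxE; apply: eq_bigr => k _.
by rewrite exprmxZ scalerA mxE /c /=; ring.
Qed.

Lemma is_derive_expmx (t : R) :
  is_derive t 1 (fun s => expmx (s *: L)) (L *m expmx (t *: L)).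
Proof.
apply/is_derive_mxP => i j; rewrite expmx_pseries.
under eq_fun do rewrite expmx_pseries mxE.
have -> : (L *m E t) i j = limn (pseries (pseries_diffs (c i j)) t).
  rewrite diffs_c (cvg_lim _ (@cvg_sum_c (L i) j t))// mxE.
  by apply: eq_bigr => l _; rewrite mxE.
(* The series and its first two formal derivatives must converge at a point of modulus larger than
   [|t|]. *)
apply: (@pseries_snd_diffs _ _ (`|t| + 1) t).
- exact: cvg_c.
- by rewrite diffs_c; apply/cvg_ex; eexists; exact: cvg_sum_c.
- by rewrite diffs_c diffs_sum_c; apply/cvg_ex; eexists; exact: cvg_sum_c.
- by rewrite [ltRHS]ger0_norm ?ltrDl// addr_ge0.
Qed.

End exponential.

Lemma expmx0 (R : realType) (n : nat) : expmx (0 : 'M[R]_n) = 1%:M.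
Proof.
(* Partial sums are constant from index 1 on; the one at index 0 is empty. *)
apply/cvg_lim => //; apply: cvg_near_cst; exists 1%N => //= -[//|N] _.
rewrite /series/= big_nat_recl//= big1 ?addr0.
  by rewrite expr0 fact0 invr1 scale1r.
by move=> k _; rewrite exprS mul0r scaler0.
Qed.

(** * Growth of the Euclidean norm along a curve *)

Lemma continuous_mulmx (R : realType) (m n p : nat) (P : 'M[R]_(m, n)) :
  continuous (mulmx P : 'M[R]_(n, p) -> 'M[R]_(m, p)).
Proof.
move=> M; apply: (@cvg_mx _ (nbhs M)) => i j; rewrite mxE.
under eq_fun do rewrite mxE.
apply: cvg_big => [|k _]; first exact: add_continuous.
by apply: cvgMr; exact: coord_continuous.
Qed.

Lemma continuous_sqr_enorm (R : realType) (n : nat) :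
  continuous (fun x : 'cV[R]_n => enorm x ^+ 2).
Proof.
have -> : (fun x : 'cV[R]_n => enorm x ^+ 2) = fun x => \sum_i x i 0 * x i 0.
  apply/funext => x; rewrite sqr_enorm mxE.
  by apply: eq_bigr => i _; rewrite mxE.
apply: continuous_big => [|i _ x]; first exact: add_continuous.
by apply: continuousM; exact: coord_continuous.
Qed.

Lemma is_derive_sqr_enorm (R : realType) (n : nat) (f : R -> 'cV[R]_n)
    (df : 'cV[R]_n) (t : R) : is_derive t 1 f df ->
  is_derive t 1 (fun s => enorm (f s) ^+ 2) (2 * ((f t)^T *m df) 0 0).
Proof.
move=> /is_derive_mxP dft; under eq_fun do rewrite sqr_enorm mxE.
rewrite mxE mulr_sumr; apply: is_derive_sumr => i; rewrite mxE.
under eq_fun do rewrite mxE.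
have d := @is_deriveM _ _ _ _ _ _ _ _ (dft i 0) (dft i 0).
by apply: (is_derive_eq d); rewrite /GRing.scale/=; ring.
Qed.

(* The mean value theorem is applied to the smooth function
   sqrt (|f|^2 + eps^2), since |f| need not be differentiable at a zero of f. *)
Lemma enorm_growth (R : realType) (n : nat) (f df : R -> 'cV[R]_n) (c : R) :
  0 <= c -> {within `[0, +oo[, continuous f} ->
  (forall t : R, 0 < t -> is_derive t 1 f (df t)) ->
  (forall t : R, 0 < t -> ((f t)^T *m df t) 0 0 <= c * enorm (f t)) ->
  forall t : R, 0 <= t -> enorm (f t) <= enorm (f 0) + c * t.
Proof.
move=> c_ge0 cf dft dot_le t; rewrite le_eqVlt => /predU1P[<-|t_gt0].
  by rewrite mulr0 addr0.
apply/ler_addgt0Pr => eps eps_gt0.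
pose h s := Num.sqrt (enorm (f s) ^+ 2 + eps ^+ 2).
have pos s : 0 < enorm (f s) ^+ 2 + eps ^+ 2.
  by rewrite ltr_wpDl ?sqr_ge0// exprn_gt0.
pose dh s := (2 * h s)^-1 * (2 * ((f s)^T *m df s) 0 0).
have hder s : s \in `]0, t[%R -> is_derive s 1 h (dh s).
  rewrite in_itv/= => /andP[s_gt0 _].
  have ds := is_derive_sqr_enorm (dft s s_gt0).
  apply: (@is_derive1_comp _ Num.sqrt (fun s => enorm (f s) ^+ 2 + eps ^+ 2)).
    exact: is_derive1_sqrt.
  have d := is_deriveD ds (is_derive_cst (eps ^+ 2) s 1).
  by apply: (is_derive_eq d); rewrite addr0.
have hcont0 : {within `[0, +oo[, continuous h}.
  apply: (@within_continuous_comp _ _ _ _ f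
    (fun x => Num.sqrt (enorm x ^+ 2 + eps ^+ 2))) => // x _.
  apply: continuous_comp; last exact: sqrt_continuous.
  apply: continuousD; last exact: cst_continuous.
  exact: continuous_sqr_enorm.
have hcont : {within `[0, t], continuous h}.
  apply: continuous_subspaceW hcont0 => s.
  by rewrite /= !in_itv/= => /andP[->].
have [s /[!in_itv]/= /andP[s_gt0 _]] := MVT t_gt0 hder hcont.
rewrite subr0 => hE.
have h_gt0 : 0 < h s by rewrite sqrtr_gt0.
have norm_le_h r : enorm (f r) <= h r.
  rewrite -[leLHS]ger0_norm ?enorm_ge0// -sqrtr_sqr ler_wsqrtr//.
  by rewrite lerDl sqr_ge0.
(* [dh s] is the inner product of [f s] and [df s] over [h s], at most [c |f s| / h s]. *)
have dh_le : dh s <= c.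
  rewrite /dh invfM mulrACA mulVf// mul1r ler_pdivrMl// mulrC.
  by rewrite (le_trans (dot_le _ s_gt0))// ler_wpM2l.
(* Squaring the right side adds a nonnegative cross term. *)
have h0_le : h 0 <= enorm (f 0) + eps.
  rewrite -[leRHS]ger0_norm ?addr_ge0 ?enorm_ge0 ?(ltW eps_gt0)//.
  rewrite -sqrtr_sqr ler_wsqrtr// sqrrD.
  by rewrite lerD2r lerDl mulrn_wge0// mulr_ge0 ?enorm_ge0 ?ltW.
have ht_le : h t <= h 0 + c * t by rewrite -lerBlDl hE ler_wpM2r// ltW.
by have := norm_le_h t; lra.
Qed.

(** * Skew-symmetry and the error estimate *)

Lemma skew_quadratic_form (R : numDomainType) (n : nat) (X : 'M[R]_n)
    (x : 'cV[R]_n) :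
  X^T = - X -> (x^T *m X *m x) 0 0 = 0.
Proof.
move=> skewX; have := dot_sym x (X *m x).
rewrite trmx_mul skewX mulmxN mulNmx [in RHS]mxE mulmxA.
by move/eqP; rewrite -subr_eq0 opprK -mulr2n mulrn_eq0/= => /eqP.
Qed.

Theorem lemma1 (R : realType) (n m : nat) (n_gt0 : (0 < n)%N)
    (n_lt_m : (n < m)%N) (L : 'M[R]_m) (G : 'M[R]_(m, n))
    (rankG : \rank G = n) (A : 'M[R]_m) (posdefA : posdefmx A)
    (v0 : 'cV[R]_n) :
  let M : 'M[R]_n := G^T *m invmx A *m G in
  let K : 'M[R]_m := L *m invmx A in
  let E : 'M[R]_(m, n) := L^T *m G + G *m invmx M *m G^T *m K *m G in
  forall v : R -> 'cV[R]_n,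
  linear_ode_solution (G^T *m K *m G *m invmx M) v0 v ->
  let u_exact (t : R) : 'cV[R]_m :=
    expmx (t *: L) *m invmx A *m G *m invmx M *m v0 in
  let u_approx (t : R) : 'cV[R]_m := invmx A *m G *m invmx M *m v t in
  let e (t : R) : 'cV[R]_m := u_approx t - u_exact t in
  L^T *m A + A *m L = 0 ->
  forall t : R, 0 <= t ->
    enorm (sqrtmx A *m e t) <=
      t * opnorm (invmx (sqrtmx A) *m E *m invmx (sqrtmx M))
        * enorm (invmx (sqrtmx M) *m v0).
Proof.
move=> M K E v [v_0 v_cont v_der] u_exact u_approx e skewAL t t_ge0.
have posM : posdefmx M by apply: posdefmx_congr => //; exact: posdefmx_inv.
have [symA _] := posdefA.
have [posS SS] := sqrtmxP posdefA; have [posT TT] := sqrtmxP posM.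
move: posS SS posT TT; set S := sqrtmx A; set T := sqrtmx M => posS SS posT TT.
have Au := posdefmx_unit posdefA; have Su := posdefmx_unit posS.
have Tu := posdefmx_unit posT.
have [symS _] := posS; have [symT _] := posT.
have symVT : (invmx T)^T = invmx T by rewrite trmx_inv symT.
have VM : invmx M = invmx T *m invmx T.
  have Mu := posdefmx_unit posM.
  by rewrite -[RHS](mulmxK Mu) -{2}TT !mulmxA mulmxKV// mulVmx// mul1mx.
have symVM : (invmx M)^T = invmx M by rewrite VM trmx_mul symVT.
have symVA : (invmx A)^T = invmx A by rewrite trmx_inv symA.
have LTA : L^T *m A = - (A *m L) by apply/eqP; rewrite -addr_eq0 skewAL.
(* [K^T = A^-1 L^T = A^-1 (L^T A) A^-1 = - L A^-1]. *)
have skewK : K^T = - K.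
  rewrite /K trmx_mul symVA -[L^T](mulmxK Au) LTA mulNmx mulmxN.
  by rewrite !mulmxA mulVmx// mul1mx.
have w_le s : 0 <= s -> enorm (invmx T *m v s) <= enorm (invmx T *m v0).
  move=> s_ge0; rewrite -[leRHS]addr0 -[X in _ + X](mul0r s) -v_0.
  pose dv r := invmx T *m (G^T *m K *m G *m invmx M *m v r).
  (* Growth rate 0: as [M^-1 = T^-1 T^-1], the inner product with the derivative is [y^T K y] for
     [y = G M^-1 v]. *)
  apply: (@enorm_growth _ _ (fun r => invmx T *m v r) dv 0)
    => // [|r r_gt0|r _].
  - by apply: within_continuous_comp v_cont => x _; exact: continuous_mulmx.
  - by apply: is_derive_mulmx; exact: v_der.
  - rewrite mul0r /dv trmx_mul symVT.
    have := skew_quadratic_form (G *m invmx M *m v r) skewK.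
    by rewrite !trmx_mul symVM {1}VM !mulmxA => ->.
have u_der (s : R) : is_derive s 1 u_exact (L *m u_exact s).
  rewrite /u_exact !mulmxA; do 4 apply: is_derive_mulmxr.
  exact: is_derive_expmx.
have e_cont : {within `[0, +oo[, continuous e}.
  apply: within_continuousB.
    by apply: within_continuous_comp v_cont => x _; exact: continuous_mulmx.
  apply: continuous_subspaceT => s; apply/differentiable_continuous.
  by apply/derivable1_diffP; exact: (@ex_derive _ _ _ _ _ _ _ (u_der s)).
have e_der (s : R) : 0 < s ->
    is_derive s 1 e (L *m e s + invmx A *m E *m invmx M *m v s).
  move=> s_gt0; apply: is_derive_eq.
    apply: is_deriveB; apply: is_derive_mulmx; exact: v_der.
  (* The first summand of [E] contributes [A^-1 L^T G M^-1 v = - L u_approx], cancelling that part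
     of [L e]; the second contributes the derivative of [u_approx]. *)
  rewrite /e /E mulmxBr addrAC; congr (_ - _).
  rewrite mulmxDr !mulmxDl !mulmxA.
  have -> : invmx A *m L^T = - K by rewrite -skewK trmx_mul symVA.
  by rewrite !mulNmx /u_approx /K addrA subrr add0r.
have e0 : e 0 = 0.
  by rewrite /e /u_exact scale0r expmx0 mul1mx /u_approx v_0 subrr.
(* Since [e 0 = 0], the bound takes the form [|S e(0)| + c t] of [enorm_growth]. *)
clearbody e E; rewrite -mulrA mulrC -[leRHS]add0r -(enorm0 R m).
rewrite -[X in enorm X + _](mulmx0 _ S) -e0.
pose de s := S *m (L *m e s + invmx A *m E *m invmx M *m v s).
apply: (@enorm_growth _ _ (fun s => S *m e s) de) => // [|||s s_gt0].
- by rewrite mulr_ge0 ?enorm_ge0 ?opnorm_ge0.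
- by apply: within_continuous_comp e_cont => x _; exact: continuous_mulmx.
- by move=> s s_gt0; apply: is_derive_mulmx; exact: e_der.
have skewAL' : (A *m L)^T = - (A *m L) by rewrite trmx_mul symA.
(* [S S = A] yields the form of [A L], and [S A^-1 E M^-1 = S^-1 E T^-1 T^-1] exposes the matrix of
   the claimed bound. *)
have -> : (S *m e s)^T *m de s = (e s)^T *m (A *m L) *m e s +
    (S *m e s)^T *m (invmx S *m E *m invmx T *m (invmx T *m v s)).
  rewrite /de !mulmxDr trmx_mul symS !mulmxA.
  rewrite -!(mulmxA (e s)^T S S) SS -!(mulmxA _ (invmx T) (invmx T)) -VM.
  by rewrite (mulmxK Au) (mulmxK Su).
rewrite mxE skew_quadratic_form// add0r (le_trans (cauchy_schwarz _ _))//.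
rewrite mulrC ler_wpM2r ?enorm_ge0// (le_trans (enorm_mul_le_opnorm _ _))//.
by rewrite ler_wpM2l ?opnorm_ge0// w_le// ltW.
Qed.
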